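(* Let $\Lambda$ be a left FPE ring. Then the natural transformation $\beta:\mathfrak{s}^{-1}\to\mathrm{Hom}_\Lambda(Tr(\mathscr{I},{}_\Lambda\Lambda),\_)$ is the zeroth right derived functor of $\mathfrak{s}^{-1}$ on right $\Lambda$-modules (that is, $R^0\mathfrak{s}^{-1}\simeq\mathrm{Hom}_\Lambda(Tr(\mathscr{I},{}_\Lambda\Lambda),\_)$, with $\beta$ corresponding to the canonical transformation $\mathfrak{s}^{-1}\to R^0\mathfrak{s}^{-1}$). Consequently, \[R^i\mathfrak{s}^{-1}\simeq\mathrm{Ext}^i_\Lambda(Tr(\mathscr{I},{}_\Lambda\Lambda),\_)\] for all integers $i$.
   Context: $\Lambda$ is left FPE if the injective envelope $I$ of the left module ${}_\Lambda\Lambda$ is finitely presented. Let $\iota:\Lambda\to I$ be this injective envelope. For a right $\Lambda$-module $M$, the injective torsion is $\mathfrak{s}(M):=\ker(1\otimes\iota:M\otimes_\Lambda\Lambda\to M\otimes_\Lambda I)\subseteq M$, and $\mathfrak{s}^{-1}(M):=M/\mathfrak{s}(M)$, viewed as an endofunctor of the category of right $\Lambda$-modules (or, forgetting structure, a functor to abelian groups). $Tr(\mathscr{I},{}_\Lambda\Lambda)$ is the trace in ${}_\Lambda\Lambda$ of the class $\mathscr{I}$ of injective left modules, i.e. the sum of images of all homomorphisms from injective left modules to ${}_\Lambda\Lambda$; it is a two-sided ideal of $\Lambda$ and is here regarded as a right $\Lambda$-module. The transformation $\beta$ is induced by the composite $M\cong\mathrm{Hom}_\Lambda(\Lambda_\Lambda,M)\to\mathrm{Hom}_\Lambda(Tr(\mathscr{I},{}_\Lambda\Lambda),M)$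 of the canonical isomorphism with restriction (this composite vanishes on $\mathfrak{s}(M)$): explicitly, $\beta_M$ sends the class of $m$ to the map $t\mapsto mt$. For an additive functor $F$, $R^iF$ denotes the $i$-th cohomology of $F$ applied to an injective resolution (with $R^iF=0$ for $i<0$), and $F\to R^0F$ is the canonical transformation ($F$ is not assumed left exact). *)

(* Defs.v *)
From HB Require Import structures.
From mathcomp Require Import all_boot all_order all_algebra.
From mathcomp Require Import generic_quotient ring_quotient.
From mathcomp Require Import boolp.
From mathcomp.multinomials Require Import freeg.

Set Implicit Arguments.
Unset Strict Implicit.
Unset Printing Implicit Defensive.

Import GRing.Theory.
Local Open Scope ring_scope.
Local Open Scope quotient_scope.

Definition linear_of (R : pzRingType) (U V : lmodType R) (f : U -> V)
  (fL : linear f) : {linear U -> V} :=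
  HB.pack_for {linear U -> V} f (GRing.isLinear.Build R U V *:%R f fL).

(* The library's submodules and subgroups are boolean predicates; a Prop-valued
   one is turned into such a predicate with asbool. *)
Section SubmodOfClosed.
Variables (R : pzRingType) (V : lmodType R) (P : V -> Prop).
Hypotheses (P0 : P 0) (PL : forall a x y, P x -> P y -> P (a *: x + y)).

Definition asbool_pred : V -> bool := fun x => `[< P x >].

Lemma asbool_pred_closed : submod_closed (asbool_pred : {pred V}).
Proof.
split=> [|a x y /asboolP Px /asboolP Py]; apply/asboolP; [exact: P0 | exact: PL].
Qed.

Definition submod_of_closed : submodClosed V :=
  HB.pack_for (submodClosed V) asbool_pred
    (GRing.isSubmodClosed.Build R V asbool_pred asbool_pred_closed).

Lemma submod_of_closedP x : (x \in submod_of_closed) <-> P x.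
Proof. exact: (iff_sym (rwP (asboolP (P x)))). Qed.

End SubmodOfClosed.

Section ZmodOfClosed.
Variables (V : zmodType) (P : V -> Prop).
Hypotheses (P0 : P 0) (PB : forall x y, P x -> P y -> P (x - y)).

Definition asbool_zpred : V -> bool := fun x => `[< P x >].

Lemma asbool_zpred_closed : zmod_closed (asbool_zpred : {pred V}).
Proof.
split=> [|x y /asboolP Px /asboolP Py]; apply/asboolP; [exact: P0 | exact: PB].
Qed.

Definition zmod_of_closed : zmodClosed V :=
  HB.pack_for (zmodClosed V) asbool_zpred
    (GRing.isZmodClosed.Build V asbool_zpred asbool_zpred_closed).

Lemma zmod_of_closedP x : (x \in zmod_of_closed) <-> P x.
Proof. exact: (iff_sym (rwP (asboolP (P x)))). Qed.

End ZmodOfClosed.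

Record submod_of (R : pzRingType) (V : lmodType R) (S : submodClosed V) :=
  SubmodOf { submod_val : V; _ : submod_val \in S }.

Section SubmodOf.
Variables (R : pzRingType) (V : lmodType R) (S : submodClosed V).
HB.instance Definition _ := [isSub for @submod_val R V S].
HB.instance Definition _ := [Choice of submod_of S by <:].
HB.instance Definition _ := [SubChoice_isSubLmodule of submod_of S by <:].
End SubmodOf.

Section QuotMod.
Variables (R : pzRingType) (V : lmodType R) (S : submodClosed V).

Definition submod_pred : V -> bool := fun x => x \in S.

Lemma submod_zmod_closed : zmod_closed (submod_pred : {pred V}).
Proof.
split=> [|x y Sx Sy]; first exact: rpred0.
by apply: rpredD => //; rewrite -scaleN1r; apply: rpredZ.
Qed.

Definition submod_zmodClosed : zmodClosed V :=
  HB.pack_for (zmodClosed V) submod_pred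
    (GRing.isZmodClosed.Build V submod_pred submod_zmod_closed).

Definition quot_mod := Quotient.quot submod_zmodClosed.
Local Notation Q := quot_mod.
HB.instance Definition _ := GRing.Zmodule.on Q.
HB.instance Definition _ := Quotient.on Q.

Definition quot_proj0 (x : V) : Q := \pi_Q x.

Lemma quot_proj0_eq (x y : V) : quot_proj0 x = quot_proj0 y <-> x - y \in S.
Proof.
have -> : (x - y \in S) = (x - y \in submod_zmodClosed) by [].
by rewrite Quotient.idealrBE; split=> /eqP.
Qed.

Definition quot_scale (a : R) (x : Q) : Q := quot_proj0 (a *: repr x).

Lemma quot_proj0_repr x : quot_proj0 (repr x) = x.
Proof. exact: reprK. Qed.

Lemma quot_proj0D x y : quot_proj0 (x + y) = quot_proj0 x + quot_proj0 y.
Proof. exact: (raddfD (\pi_(Quotient.quot submod_zmodClosed) : {additive _ -> _})). Qed.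

Lemma quot_scale_proj a x : quot_scale a (quot_proj0 x) = quot_proj0 (a *: x).
Proof.
apply/quot_proj0_eq; rewrite -scalerBr rpredZ //.
by apply/quot_proj0_eq; rewrite quot_proj0_repr.
Qed.

Lemma quot_scaleA a b x : quot_scale a (quot_scale b x) = quot_scale (a * b) x.
Proof. by rewrite -[x]quot_proj0_repr !quot_scale_proj scalerA. Qed.

Lemma quot_scale1 : left_id 1 quot_scale.
Proof. by move=> x; rewrite -[x]quot_proj0_repr !quot_scale_proj scale1r. Qed.

Lemma quot_scaleDr : right_distributive quot_scale +%R.
Proof.
move=> a x y; rewrite -[x]quot_proj0_repr -[y]quot_proj0_repr.
by rewrite -quot_proj0D !quot_scale_proj scalerDr quot_proj0D.
Qed.

Lemma quot_scaleDl x : {morph quot_scale^~ x : a b / a + b}.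
Proof.
move=> a b; rewrite -[x]quot_proj0_repr !quot_scale_proj.
by rewrite scalerDl quot_proj0D.
Qed.

HB.instance Definition _ := GRing.Zmodule_isLmodule.Build R Q
  quot_scaleA quot_scale1 quot_scaleDr quot_scaleDl.

Lemma quot_proj_linear : linear quot_proj0.
Proof.
move=> a x y; rewrite quot_proj0D; congr (_ + _).
by rewrite -[RHS]/(quot_scale a _) quot_scale_proj.
Qed.

Definition quot_proj : {linear V -> Q} := linear_of quot_proj_linear.

Lemma quot_projP (x y : V) : quot_proj x = quot_proj y <-> x - y \in S.
Proof. exact: quot_proj0_eq. Qed.

Lemma quot_proj_surj (q : Q) : quot_proj (repr q) = q.
Proof. exact: quot_proj0_repr. Qed.

Lemma quot_proj_eq0 x : quot_proj x = 0 <-> x \in S.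
Proof. by rewrite -(linear0 quot_proj) quot_projP subr0. Qed.

Variables (W : lmodType R) (f : {linear V -> W}).
Hypothesis f0 : forall x, x \in S -> f x = 0.

Lemma quot_lift_repr x : f (repr (quot_proj x)) = f x.
Proof.
apply/eqP; rewrite -subr_eq0 -linearB f0 //.
by apply/quot_projP; rewrite quot_proj_surj.
Qed.

Lemma quot_lift_linear : linear (fun q : Q => f (repr q)).
Proof.
move=> a x y; rewrite -[x]quot_proj_surj -[y]quot_proj_surj.
by rewrite -linearP !quot_lift_repr linearP.
Qed.

Definition quot_lift : {linear Q -> W} := linear_of quot_lift_linear.

Lemma quot_liftE x : quot_lift (quot_proj x) = f x.
Proof. exact: quot_lift_repr. Qed.

End QuotMod.

Section Modules.
Variable R : pzRingType.

Definition injective_module (J : lmodType R) : Prop :=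
  forall (A B : lmodType R) (u : {linear A -> B}) (v : {linear A -> J}),
  injective u -> exists w : {linear B -> J}, forall x, w (u x) = v x.

Definition essential_mono (M J : lmodType R) (j : {linear M -> J}) : Prop :=
  injective j /\
  forall S : submodClosed J,
    (forall x, j x \in S -> x = 0) -> forall y, y \in S -> y = 0.

Record injective_envelope (M : lmodType R) := InjectiveEnvelope {
  env_mod :> lmodType R;
  env_map : {linear M -> env_mod};
  env_injective : injective_module env_mod;
  env_essential : essential_mono env_map
}.

Definition finitely_presented (M : lmodType R) : Prop :=
  exists (n : nat) (p : {linear 'rV[R]_n -> M}),
    (forall y, exists x, p x = y) /\
    exists (m : nat) (k : 'I_m -> 'rV[R]_n),
      forall x, p x = 0 <-> exists c : 'I_m -> R, x = \sum_i c i *: k i.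

(* The trace of the class C in M; elements of the sum of the images are finite
   sums of elements of images. *)
Definition in_trace (C : lmodType R -> Prop) (M : lmodType R) (x : M) : Prop :=
  exists2 s : seq M,
    {in s, forall y, exists (J : lmodType R) (f : {linear J -> M}) (z : J),
      C J /\ y = f z}
    & x = \sum_(y <- s) y.

End Modules.

Definition left_FPE (R : pzRingType) : Prop :=
  exists E : injective_envelope R^o, finitely_presented E.


(* Right R-modules are left modules over the converse ring R^c; the right
   action of a : R on x is a *: x, and R_R is the type below. *)
Definition right_regular (R : pzRingType) : lmodType R^c := (R^c)^o.

(* The quotient of the free abelian group on M * N by the subgroup generated by
   the relations tensor_gen. *)
Section Tensor.
Variables (R : pzRingType) (M : lmodType R^c) (N : lmodType R).
Local Notation free_ab := {freeg (M * N)%type / int}.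

Definition tensor_gen (D : free_ab) : Prop :=
  [\/ exists (x x' : M) (y : N),
        D = << (x + x', y) >> - << (x, y) >> - << (x', y) >>,
      exists (x : M) (y y' : N),
        D = << (x, y + y') >> - << (x, y) >> - << (x, y') >>
    | exists (a : R) (x : M) (y : N),
        D = << ((a : R^c) *: x, y) >> - << (x, a *: y) >> ].

Definition tensor_rel (D : free_ab) : Prop :=
  forall G : zmodClosed free_ab, (forall g, tensor_gen g -> g \in G) -> D \in G.

Lemma tensor_rel0 : tensor_rel 0.
Proof. by move=> G _; apply: rpred0. Qed.

Lemma tensor_relB D D' : tensor_rel D -> tensor_rel D' -> tensor_rel (D - D').
Proof. by move=> rD rD' G GP; apply: rpredB; [apply: rD | apply: rD']. Qed.

Definition tensor : zmodType :=
  Quotient.quot (zmod_of_closed tensor_rel0 tensor_relB).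

Definition tensor_proj (D : free_ab) : tensor :=
  \pi_(Quotient.quot (zmod_of_closed tensor_rel0 tensor_relB)) D.

Definition tens (x : M) (y : N) : tensor := tensor_proj << (x, y) >>.

Definition tensor_repr (t : tensor) : free_ab :=
  repr (t : Quotient.quot (zmod_of_closed tensor_rel0 tensor_relB)).

Lemma tensor_projK t : tensor_proj (tensor_repr t) = t.
Proof. exact: reprK. Qed.

Lemma tensor_projB D D' : tensor_proj (D - D') = tensor_proj D - tensor_proj D'.
Proof.
exact: (raddfB (\pi_(Quotient.quot (zmod_of_closed tensor_rel0 tensor_relB))
   : {additive _ -> _})).
Qed.

Lemma tensor_projP D D' :
  tensor_proj D = tensor_proj D' <-> tensor_rel (D - D').
Proof.
rewrite -(zmod_of_closedP tensor_rel0 tensor_relB) Quotient.idealrBE.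
by split=> /eqP.
Qed.

Lemma tensDl x x' y : tens (x + x') y = tens x y + tens x' y.
Proof.
apply/eqP; rewrite -subr_eq0 opprD addrA -!tensor_projB; apply/eqP.
rewrite -[RHS](subrr (tensor_proj 0)) -tensor_projB subr0.
apply/tensor_projP; rewrite subr0 => G; apply.
by apply: Or31; exists x, x', y.
Qed.

Lemma tensDr x y y' : tens x (y + y') = tens x y + tens x y'.
Proof.
apply/eqP; rewrite -subr_eq0 opprD addrA -!tensor_projB; apply/eqP.
rewrite -[RHS](subrr (tensor_proj 0)) -tensor_projB subr0.
apply/tensor_projP; rewrite subr0 => G; apply.
by apply: Or32; exists x, y, y'.
Qed.

Lemma tens_balanced (a : R) x y : tens ((a : R^c) *: x) y = tens x (a *: y).
Proof. by apply/tensor_projP => G; apply; apply: Or33; exists a, x, y. Qed.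

Lemma tens0l y : tens 0 y = 0.
Proof. by apply: (addrI (tens 0 y)); rewrite -tensDl !addr0. Qed.

Variables (A : zmodType) (b : M -> N -> A).
Hypotheses (bDl : forall x x' y, b (x + x') y = b x y + b x' y)
           (bDr : forall x y y', b x (y + y') = b x y + b x y')
           (bZ : forall (a : R) x y, b ((a : R^c) *: x) y = b x (a *: y)).

Definition free_lift (D : free_ab) : A :=
  fglift (fun xy : M * N => b xy.1 xy.2 : zmodule A) D.

Lemma free_liftU x y : free_lift << (x, y) >> = b x y.
Proof. by rewrite /free_lift liftU scale1r. Qed.

Lemma free_liftB D D' : free_lift (D - D') = free_lift D - free_lift D'.
Proof.
exact: (lift_is_additive (fun xy : M * N => b xy.1 xy.2 : zmodule A) D D').
Qed.

Definition tensor_lift (t : tensor) : A := free_lift (tensor_repr t).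

Lemma tensor_lift_proj D : tensor_lift (tensor_proj D) = free_lift D.
Proof.
apply/eqP; rewrite -subr_eq0 -free_liftB; apply/eqP.
have: tensor_rel (tensor_repr (tensor_proj D) - D).
  by apply/tensor_projP; rewrite tensor_projK.
have K0 : free_lift 0 = 0 by rewrite -[0](subrr 0) free_liftB subrr.
have KB : forall D D', free_lift D = 0 -> free_lift D' = 0 -> free_lift (D - D') = 0.
  by move=> D1 D2 h1 h2; rewrite free_liftB h1 h2 subrr.
move=> /(_ (zmod_of_closed K0 KB)) h; apply/(zmod_of_closedP K0 KB).
apply: h => g [[x [x' [y ->]]]|[x [y [y' ->]]]|[a [x [y ->]]]];
  apply/zmod_of_closedP; rewrite !free_liftB !free_liftU ?bDl ?bDr ?bZ ?subrr //.
- by rewrite addrAC addrK subrr.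
- by rewrite addrAC addrK subrr.
Qed.

Lemma tensor_liftE x y : tensor_lift (tens x y) = b x y.
Proof. by rewrite tensor_lift_proj free_liftU. Qed.

Lemma tensor_liftB t t' : tensor_lift (t - t') = tensor_lift t - tensor_lift t'.
Proof.
rewrite -[t]tensor_projK -[t']tensor_projK -tensor_projB.
by rewrite !tensor_lift_proj free_liftB.
Qed.

End Tensor.

Section TensorMap.
Variables (R : pzRingType) (M : lmodType R^c).
Variables (N N' : lmodType R) (f : {linear N -> N'}).

Definition tensor_map : tensor M N -> tensor M N' :=
  tensor_lift (fun x y => tens x (f y)).

Lemma tensor_mapE x y : tensor_map (tens x y) = tens x (f y).
Proof.
apply: tensor_liftE => [x1 x2 z|x1 y1 y2|a x1 y1].
- exact: tensDl.
- by rewrite linearD tensDr.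
- by rewrite linearZ tens_balanced.
Qed.

End TensorMap.

Section Torsion.
Variables (R : pzRingType) (E : injective_envelope R^o).
Local Notation iota := (env_map E).

(* The kernel of 1 (x) iota : M (x) R -> M (x) E, transported to M along the
   canonical isomorphism m |-> m (x) 1 from M to M (x) R. *)
Definition in_torsion (M : lmodType R^c) (m : M) : Prop :=
  tensor_map iota (tens m (1 : R^o)) = 0.

Lemma in_torsionE (M : lmodType R^c) (m : M) :
  in_torsion m <-> tens m (iota (1 : R^o)) = 0.
Proof. by rewrite /in_torsion tensor_mapE. Qed.

Lemma extend_iota (J : lmodType R) (z : J) : injective_module J ->
  exists g : {linear E -> J}, g (iota (1 : R^o)) = z.
Proof.
move=> Jinj.
have vL : linear (fun a : R^o => (a : R) *: z).
  by move=> a x y; rewrite scalerDl scalerA.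
have [g gE] := Jinj _ _ iota (linear_of vL) (proj1 (env_essential E)).
by exists g; rewrite gE /= scale1r.
Qed.

Lemma in_torsion0 (M : lmodType R^c) : in_torsion (0 : M).
Proof. by apply/in_torsionE; rewrite tens0l. Qed.

Lemma in_torsionL (M : lmodType R^c) (a : R^c) (x y : M) :
  in_torsion x -> in_torsion y -> in_torsion (a *: x + y).
Proof.
move=> /in_torsionE x0 /in_torsionE y0; apply/in_torsionE.
rewrite tensDl y0 addr0 tens_balanced.
have [g <-] := extend_iota ((a : R) *: iota (1 : R^o)) (@env_injective _ _ E).
have h0 : tensor_map g (tens x (iota (1 : R^o))) = tensor_map g (tens 0 0).
  by rewrite x0 tens0l.
by rewrite !tensor_mapE tens0l in h0.
Qed.

Definition torsion (M : lmodType R^c) : submodClosed M :=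
  submod_of_closed (@in_torsion0 M) (@in_torsionL M).

Lemma in_torsion_map (M N : lmodType R^c) (f : {linear M -> N}) m :
  in_torsion m -> in_torsion (f m).
Proof.
move=> /in_torsionE m0; apply/in_torsionE.
have fD x x' (y : E) : tens (f (x + x')) y = tens (f x) y + tens (f x') y.
  by rewrite linearD tensDl.
have fr x (y y' : E) : tens (f x) (y + y') = tens (f x) y + tens (f x) y'.
  exact: tensDr.
have fZ (a : R) x (y : E) : tens (f ((a : R^c) *: x)) y = tens (f x) (a *: y).
  by rewrite linearZ tens_balanced.
rewrite -(tensor_liftE fD fr fZ) m0.
by rewrite -(tens0l M (0 : E)) (tensor_liftE fD fr fZ) linear0 tens0l.
Qed.

End Torsion.

Record two_sided_ideal (R : pzRingType) := TwoSidedIdeal {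
  ideal_right :> submodClosed (right_regular R);
  ideal_left : forall (a : R) (x : right_regular R),
    x \in ideal_right -> ((a * (x : R))%R : right_regular R) \in ideal_right
}.

Section Trace.
Variable R : pzRingType.
Local Notation in_tr := (@in_trace R (@injective_module R) R^o).

Lemma in_trace0 : in_tr 0.
Proof. by exists [::]; rewrite ?big_nil. Qed.

Lemma in_traceD x y : in_tr x -> in_tr y -> in_tr (x + y).
Proof.
move=> [s sP ->] [t tP ->]; exists (s ++ t); last by rewrite big_cat.
by move=> z; rewrite mem_cat => /orP[/sP|/tP].
Qed.

Lemma in_trace_map (f : {additive R^o -> R^o}) x :
  (forall (J : lmodType R) (g : {linear J -> R^o}) (z : J), injective_module J ->
    exists (h : {linear J -> R^o}) (w : J), f (g z) = h w) ->
  in_tr x -> in_tr (f x).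
Proof.
move=> fP [s sP ->]; exists (map f s); last by rewrite raddf_sum big_map.
move=> _ /mapP[y /sP[J [g [z [Jinj ->]]]] ->].
by have [h [w e]] := fP J g z Jinj; exists J, h, w.
Qed.

Lemma in_traceMl (a : R) (x : R^o) : in_tr x -> in_tr (a *: x).
Proof.
apply: (in_trace_map (f := GRing.scale a)) => J g z _.
by exists g, (a *: z); rewrite linearZ.
Qed.

Lemma in_traceMr (a : R) (x : R^o) : in_tr x -> in_tr ((x : R) * a).
Proof.
have rL : linear (fun y : R^o => (y : R) * a : R^o).
  by move=> b u v; rewrite mulrDl -mulrA.
apply: (in_trace_map (f := linear_of rL)) => J g z _.
by exists (linear_of rL \o g), z.
Qed.

Lemma in_traceL (a : R^c) (x y : right_regular R) :
  in_tr x -> in_tr y -> in_tr (a *: x + y).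
Proof. by move=> tx ty; exact: (in_traceD (in_traceMr a tx) ty). Qed.

Definition trace_right : submodClosed (right_regular R) :=
  @submod_of_closed R^c (right_regular R) in_tr in_trace0 in_traceL.

Lemma trace_left (a : R) (x : right_regular R) :
  x \in trace_right -> ((a * (x : R))%R : right_regular R) \in trace_right.
Proof. by move=> /submod_of_closedP h; apply/submod_of_closedP/in_traceMl. Qed.

Definition trace_ideal : two_sided_ideal R := TwoSidedIdeal trace_left.

End Trace.

Section Functors.
Variables R S : pzRingType.

(* Additive functors from left R-modules to left S-modules; fmap_ext states that
   parallel morphisms are identified when they agree pointwise. *)
Record functor := Functor {
  fobj :> lmodType R -> lmodType S;
  fmap : forall M N : lmodType R,
    {linear M -> N} -> {linear fobj M -> fobj N};
  fmap_ext : forall (M N : lmodType R) (f g : {linear M -> N}), f =1 g -> fmap f =1 fmap g;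
  fmap_id : forall M : lmodType R, fmap (idfun : {linear M -> M}) =1 id;
  fmap_comp : forall (L M N : lmodType R) (g : {linear M -> N}) (f : {linear L -> M}),
    fmap (g \o f) =1 fmap g \o fmap f;
  fmap_add : forall (M N : lmodType R) (f g : {linear M -> N}),
    fmap (f \+ g) =1 fmap f \+ fmap g
}.

Record nat_trans (F G : functor) := NatTrans {
  nt_map :> forall M : lmodType R, {linear F M -> G M};
  nt_natural : forall (M N : lmodType R) (f : {linear M -> N}) (x : F M),
    nt_map N (fmap F f x) = fmap G f (nt_map M x)
}.

Definition is_nat_iso (F G : functor) (t : nat_trans F G) : Prop :=
  forall M, bijective (t M).

Definition nat_isomorphic (F G : functor) : Prop :=
  exists t : nat_trans F G, is_nat_iso t.

Lemma row0_eq (x y : 'rV[S]_0) : x = y.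
Proof. by rewrite [x]thinmx0 [y]thinmx0. Qed.

Definition zero_functor : functor :=
  @Functor (fun=> 'rV[S]_0) (fun M N _ => idfun)
    (fun _ _ _ _ _ _ => row0_eq _ _) (fun _ _ => row0_eq _ _)
    (fun _ _ _ _ _ _ => row0_eq _ _) (fun _ _ _ _ _ => row0_eq _ _).

End Functors.

Section Hom.
Variables (R : pzRingType) (T : two_sided_ideal R) (M : lmodType R^c).

Definition hom : Type := {linear submod_of T -> M}.

HB.instance Definition _ := gen_eqMixin hom.
HB.instance Definition _ := gen_choiceMixin hom.

Lemma hom_eq (f g : hom) : (forall t, f t = g t) -> f = g.
Proof.
case: f => f fc; case: g => g gc /= /funext e; subst g.
congr (GRing.Linear.Pack _).
case: fc => [[fD] [fZ]]; case: gc => [[gD] [gZ]].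
by rewrite (Prop_irrelevance fD gD) (Prop_irrelevance fZ gZ).
Qed.

Definition hom0 : hom := \0.
Definition homN (f : hom) : hom := \- f.
Definition homD (f g : hom) : hom := f \+ g.

Lemma homDA : associative homD.
Proof. by move=> f g h; apply: hom_eq => t /=; rewrite addrA. Qed.
Lemma homDC : commutative homD.
Proof. by move=> f g; apply: hom_eq => t /=; rewrite addrC. Qed.
Lemma hom0D : left_id hom0 homD.
Proof. by move=> f; apply: hom_eq => t /=; rewrite add0r. Qed.
Lemma homND : left_inverse hom0 homN homD.
Proof. by move=> f; apply: hom_eq => t /=; rewrite addNr. Qed.

HB.instance Definition _ := GRing.isZmodule.Build hom homDA homDC hom0D homND.

Definition ideal_lmul (a : R) (t : submod_of T) : submod_of T :=
  SubmodOf (ideal_left a (valP t)).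

Lemma ideal_lmul_linear a : linear (ideal_lmul a).
Proof. by move=> b x y; apply: val_inj; rewrite /= mulrDr mulrA. Qed.

Definition hom_scale (a : R^c) (f : hom) : hom :=
  f \o linear_of (ideal_lmul_linear a).

Lemma hom_scaleE a f t : hom_scale a f t = f (ideal_lmul a t).
Proof. by []. Qed.

Lemma hom_scaleA a b f : hom_scale a (hom_scale b f) = hom_scale (a * b) f.
Proof.
apply: hom_eq => t; rewrite !hom_scaleE; congr (f _).
by apply: val_inj; rewrite /= mulrA.
Qed.
Lemma hom_scale1 : left_id 1 hom_scale.
Proof.
move=> f; apply: hom_eq => t; rewrite hom_scaleE; congr (f _).
by apply: val_inj; rewrite /= mul1r.
Qed.
Lemma hom_scaleDr : right_distributive hom_scale +%R.
Proof. by move=> a f g; apply: hom_eq. Qed.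
Lemma hom_scaleDl f : {morph hom_scale^~ f : a b / a + b}.
Proof.
move=> a b; apply: hom_eq => t.
rewrite -[RHS]/(f (ideal_lmul a t) + f (ideal_lmul b t)) hom_scaleE -linearD.
by congr (f _); apply: val_inj; rewrite /= mulrDl.
Qed.

HB.instance Definition _ := GRing.Zmodule_isLmodule.Build R^c hom
  hom_scaleA hom_scale1 hom_scaleDr hom_scaleDl.

End Hom.

Section SubQuotMaps.
Variables (R : pzRingType) (V W : lmodType R) (f : {linear V -> W}).

Section SubMap.
Variables (S : submodClosed V) (S' : submodClosed W).
Hypothesis fS : forall x, x \in S -> f x \in S'.

Definition sub_fun (x : submod_of S) : submod_of S' := SubmodOf (fS (valP x)).

Lemma sub_fun_linear : linear sub_fun.
Proof. by move=> a x y; apply: val_inj; rewrite /= linearP. Qed.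

Definition sub_map : {linear submod_of S -> submod_of S'} :=
  linear_of sub_fun_linear.
End SubMap.

Section QuotMap.
Variables (S : submodClosed V) (S' : submodClosed W).
Hypothesis fS : forall x, x \in S -> f x \in S'.

Lemma quot_map_vanish x : x \in S -> (quot_proj S' \o f) x = 0.
Proof. by move=> /fS h; apply/quot_proj_eq0. Qed.

Definition quot_map : {linear quot_mod S -> quot_mod S'} :=
  quot_lift (f := quot_proj S' \o f) quot_map_vanish.

Lemma quot_mapE x : quot_map (quot_proj S x) = quot_proj S' (f x).
Proof. exact: quot_liftE. Qed.
End QuotMap.

End SubQuotMaps.

Section HomFunctor.
Variables (R : pzRingType) (T : two_sided_ideal R).

Definition hom_fun (M N : lmodType R^c) (f : {linear M -> N})
  (h : hom T M) : hom T N := f \o h.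

Lemma hom_fun_linear (M N : lmodType R^c) (f : {linear M -> N}) : linear (@hom_fun M N f).
Proof.
move=> a h k; apply: hom_eq => t.
rewrite -[LHS]/(f (h (@ideal_lmul R _ a t) + k t)).
by rewrite -[RHS]/(f (h (@ideal_lmul R _ a t)) + f (k t)) linearD.
Qed.

Definition hom_map (M N : lmodType R^c) (f : {linear M -> N}) :
  {linear hom T M -> hom T N} := linear_of (hom_fun_linear f).

Lemma hom_map_ext (M N : lmodType R^c) (f g : {linear M -> N}) :
  f =1 g -> hom_map f =1 hom_map g.
Proof. by move=> fg h; apply: hom_eq => t; apply: fg. Qed.
Lemma hom_map_id (M : lmodType R^c) :
  hom_map (idfun : {linear M -> M}) =1 id.
Proof. by move=> h; apply: hom_eq. Qed.
Lemma hom_map_comp (L M N : lmodType R^c)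
    (g : {linear M -> N}) (f : {linear L -> M}) :
  hom_map (g \o f) =1 hom_map g \o hom_map f.
Proof. by move=> h; apply: hom_eq. Qed.
Lemma hom_map_add (M N : lmodType R^c) (f g : {linear M -> N}) :
  hom_map (f \+ g) =1 hom_map f \+ hom_map g.
Proof. by move=> h; apply: hom_eq. Qed.

(* Hom_R(T, M) carries the right action (f a)(t) = f (a t). *)
Definition hom_functor : functor R^c R^c :=
  Functor hom_map_ext hom_map_id hom_map_comp hom_map_add.

End HomFunctor.

Section TorsionQuotient.
Variables (R : pzRingType) (E : injective_envelope R^o).

Lemma torsion_map (M N : lmodType R^c) (f : {linear M -> N}) m :
  m \in torsion E M -> f m \in torsion E N.
Proof.
by move=> /submod_of_closedP h; apply/submod_of_closedP/in_torsion_map.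
Qed.

Definition tq_map (M N : lmodType R^c) (f : {linear M -> N}) :
  {linear quot_mod (torsion E M) -> quot_mod (torsion E N)} :=
  quot_map (torsion_map f).

Lemma tq_mapE (M N : lmodType R^c) (f : {linear M -> N}) m :
  tq_map f (quot_proj _ m) = quot_proj _ (f m).
Proof. exact: quot_mapE. Qed.

Lemma tq_map_ext (M N : lmodType R^c) (f g : {linear M -> N}) :
  f =1 g -> tq_map f =1 tq_map g.
Proof. by move=> fg q; rewrite -[q]quot_proj_surj !tq_mapE fg. Qed.
Lemma tq_map_id (M : lmodType R^c) : tq_map (idfun : {linear M -> M}) =1 id.
Proof. by move=> q; rewrite -[q]quot_proj_surj tq_mapE. Qed.
Lemma tq_map_comp (L M N : lmodType R^c)
    (g : {linear M -> N}) (f : {linear L -> M}) :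
  tq_map (g \o f) =1 tq_map g \o tq_map f.
Proof.
move=> q; rewrite -[q]quot_proj_surj -[RHS]/(tq_map g (tq_map f _)).
by rewrite !tq_mapE.
Qed.
Lemma tq_map_add (M N : lmodType R^c) (f g : {linear M -> N}) :
  tq_map (f \+ g) =1 tq_map f \+ tq_map g.
Proof.
move=> q; rewrite -[q]quot_proj_surj -[RHS]/(tq_map f _ + tq_map g _).
by rewrite !tq_mapE -linearD.
Qed.

Definition torsion_quotient : functor R^c R^c :=
  Functor tq_map_ext tq_map_id tq_map_comp tq_map_add.

Lemma torsion_trace (M : lmodType R^c) (m : M) (t : right_regular R) :
  m \in torsion E M -> t \in trace_ideal R -> (t : R^c) *: m = 0.
Proof.
move=> /submod_of_closedP/in_torsionE m0 /submod_of_closedP[s sP ->].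
have bl (x x' : M) (y : R^o) :
    (y : R^c) *: (x + x') = (y : R^c) *: x + (y : R^c) *: x' by rewrite scalerDr.
have br (x : M) (y y' : R^o) :
  ((y + y' : R^o) : R^c) *: x = (y : R^c) *: x + (y' : R^c) *: x by rewrite scalerDl.
have bZ (a : R) (x : M) (y : R^o) :
  (y : R^c) *: ((a : R^c) *: x) = ((a *: y : R^o) : R^c) *: x by rewrite scalerA.
have zero (f : {linear E -> R^o}) :
    (f (env_map E (1 : R^o)) : R^c) *: m = 0.
  rewrite -(tensor_liftE bl br bZ) -tensor_mapE m0.
  by rewrite -(tens0l M (0 : E)) tensor_mapE (tensor_liftE bl br bZ) scaler0.
rewrite scaler_suml big1_seq // => y /andP[_ /sP].
move=> [J [f [z [Jinj ->]]]]; have [g <-] := extend_iota E z Jinj.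
exact: (zero (f \o g)).
Qed.

Section Beta.
Variable M : lmodType R^c.
Local Notation T := (trace_ideal R).

Section BetaAt.
Variable m : M.
Definition beta_pre_fun (t : submod_of T) : M := (submod_val t : R^c) *: m.

Lemma beta_pre_fun_linear : linear beta_pre_fun.
Proof. by move=> a t u; rewrite /beta_pre_fun /= scalerDl scalerA. Qed.

Definition beta_pre : hom T M := linear_of beta_pre_fun_linear.
End BetaAt.

Lemma beta_pre_linear : linear beta_pre.
Proof.
move=> a m n; apply: hom_eq => t.
rewrite -[LHS]/((submod_val t : R^c) *: (a *: m + n)).
rewrite -[RHS]/((submod_val (@ideal_lmul R _ a t) : R^c) *: m
                + (submod_val t : R^c) *: n).
by rewrite scalerDr scalerA.
Qed.

Lemma beta_pre_vanish m : m \in torsion E M -> linear_of beta_pre_linear m = 0.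
Proof. by move=> m0; apply: hom_eq => t; apply: torsion_trace (valP t). Qed.

(* beta_M maps the class of m to t |-> m t. *)
Definition beta_map :
  {linear torsion_quotient M -> hom_functor (trace_ideal R) M} :=
  quot_lift beta_pre_vanish.

Lemma beta_mapE m t :
  (beta_map (quot_proj _ m) : hom T M) t = (submod_val t : R^c) *: m.
Proof. by rewrite quot_liftE. Qed.

End Beta.

Lemma beta_natural (M N : lmodType R^c) (f : {linear M -> N})
    (x : torsion_quotient M) :
  beta_map N (fmap torsion_quotient f x)
  = fmap (hom_functor (trace_ideal R)) f (beta_map M x).
Proof.
rewrite -[x]quot_proj_surj; move: (repr x) => m.
rewrite -[fmap torsion_quotient f _]/(tq_map f _) tq_mapE.
apply: hom_eq => t; rewrite beta_mapE.
rewrite -[RHS]/(f ((beta_map M (quot_proj _ m) : hom _ M) t)).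
by rewrite beta_mapE linearZ.
Qed.

Definition beta : nat_trans torsion_quotient (hom_functor (trace_ideal R)) :=
  NatTrans beta_natural.

End TorsionQuotient.

Section Cohomology.
Variables (S : pzRingType) (X : nat -> lmodType S).
Variable d : forall n, {linear X n -> X n.+1}.

Definition cocycles n : submodClosed (X n) :=
  @submod_of_closed S (X n) (fun x => d n x = 0) (linear0 (d n))
    (fun a x y x0 y0 => etrans (linearP (d n) a x y)
      (etrans (f_equal2 (fun u v => a *: u + v) x0 y0)
              (etrans (addr0 _) (scaler0 _ a)))).

Definition is_coboundary n : X n -> Prop :=
  match n with
  | 0 => fun x => x = 0
  | m.+1 => fun x => exists y : X m, x = d m y
  end.

Lemma is_coboundary0 n : is_coboundary (0 : X n).
Proof. by case: n => [|n] //=; exists 0; rewrite linear0. Qed.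

Lemma is_coboundaryL n a (x y : X n) :
  is_coboundary x -> is_coboundary y -> is_coboundary (a *: x + y).
Proof.
case: n x y => [|n] x y /=; first by move=> -> ->; rewrite scaler0 addr0.
by move=> [u ->] [v ->]; exists (a *: u + v); rewrite linearP.
Qed.

Definition coboundaries n : submodClosed (submod_of (cocycles n)) :=
  @submod_of_closed S (submod_of (cocycles n))
    (fun z => is_coboundary (submod_val z))
    (is_coboundary0 n) (fun a x y => @is_coboundaryL n a _ _).

Definition cohomology n : lmodType S := quot_mod (coboundaries n).

Definition coclass n (z : submod_of (cocycles n)) : cohomology n :=
  quot_proj (coboundaries n) z.

End Cohomology.

Section CohomologyMap.
Variables (S : pzRingType) (X Y : nat -> lmodType S).
Variable dX : forall n, {linear X n -> X n.+1}.
Variable dY : forall n, {linear Y n -> Y n.+1}.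
Variable f : forall n, {linear X n -> Y n}.
Hypothesis fd : forall n x, f n.+1 (dX n x) = dY n (f n x).

Lemma cocycle_map n x : x \in cocycles dX n -> f n x \in cocycles dY n.
Proof.
move=> /submod_of_closedP x0; apply/submod_of_closedP.
by rewrite -fd x0 linear0.
Qed.

Lemma coboundary_map n (z : submod_of (cocycles dX n)) :
  z \in coboundaries dX n ->
  sub_map (cocycle_map (n := n)) z \in coboundaries dY n.
Proof.
move=> /submod_of_closedP bz; apply/submod_of_closedP.
case: n z bz => [|n] z /=; first by rewrite /sub_fun /= => ->; rewrite linear0.
by move=> [y e]; exists (f n y); rewrite e fd.
Qed.

Definition cohomology_map n : {linear cohomology dX n -> cohomology dY n} :=
  quot_map (coboundary_map (n := n)).

Lemma cohomology_mapE n z :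
  cohomology_map n (coclass z) = coclass (sub_map (cocycle_map (n := n)) z).
Proof. exact: quot_mapE. Qed.

End CohomologyMap.

Lemma coclass_eq (S : pzRingType) (X : nat -> lmodType S)
    (d : forall n, {linear X n -> X n.+1}) n (z z' : submod_of (cocycles d n)) :
  coclass z = coclass z' <->
  is_coboundary d (submod_val z - submod_val z').
Proof.
split=> [/quot_projP/submod_of_closedP //|h].
by apply/quot_projP/submod_of_closedP.
Qed.

Lemma coclass_surj (S : pzRingType) (X : nat -> lmodType S)
    (d : forall n, {linear X n -> X n.+1}) n (c : cohomology d n) :
  exists z : submod_of (cocycles d n), c = coclass z.
Proof. by exists (repr c); rewrite /coclass quot_proj_surj. Qed.

Section Resolutions.
Variable R : pzRingType.

Record injective_resolution (M : lmodType R) := InjectiveResolution {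
  res_obj :> nat -> lmodType R;
  res_d : forall n, {linear res_obj n -> res_obj n.+1};
  res_aug : {linear M -> res_obj 0};
  res_injective : forall n, injective_module (res_obj n);
  res_aug_inj : injective res_aug;
  res_exact0 : forall x, res_d 0 x = 0 <-> exists m, x = res_aug m;
  res_exactS : forall n x, res_d n.+1 x = 0 <-> exists y, x = res_d n y
}.

Lemma injective_extend (J A B : lmodType R) (u : {linear A -> B})
    (v : {linear A -> J}) :
  injective_module J -> (forall x, u x = 0 -> v x = 0) ->
  exists w : {linear B -> J}, forall x, w (u x) = v x.
Proof.
move=> Jinj uv.
have kL a x y : u x = 0 -> u y = 0 -> u (a *: x + y) = 0.
  by move=> x0 y0; rewrite linearP x0 y0 scaler0 addr0.
pose K := @submod_of_closed _ _ (fun x => u x = 0) (linear0 u) kL.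
have uK x : x \in K -> u x = 0 by move/submod_of_closedP.
have vK x : x \in K -> v x = 0 by move=> /uK/uv.
have inj : injective (quot_lift uK).
  move=> p q; rewrite -[p]quot_proj_surj -[q]quot_proj_surj !quot_liftE => e.
  by apply/quot_projP/submod_of_closedP; rewrite linearB e subrr.
have [w wE] := Jinj _ _ (quot_lift uK) (quot_lift vK) inj.
by exists w => x; rewrite -(quot_liftE uK) wE quot_liftE.
Qed.

Section Lifting.
Variables (M N : lmodType R).
Variables (P : injective_resolution M) (Q : injective_resolution N).

Definition lifts (f : {linear M -> N}) (g : forall n, {linear P n -> Q n}) :
  Prop :=
  (forall m, g 0 (res_aug P m) = res_aug Q (f m)) /\
  (forall n x, g n.+1 (res_d P n x) = res_d Q n (g n x)).

Lemma lift_exists (f : {linear M -> N}) : exists g, lifts f g.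
Proof.
have augK (x : M) : res_aug P x = 0 -> (res_aug Q \o f) x = 0.
  move=> x0; have -> : x = 0 by apply: (@res_aug_inj _ P); rewrite linear0.
  by rewrite linear0.
have [g0 g0E] := injective_extend (@res_injective _ Q 0) augK.
pose good n (g : {linear P n -> Q n}) :=
  forall x, res_d P n x = 0 -> res_d Q n (g x) = 0.
have g0good : good 0 g0.
  move=> x /res_exact0[m ->]; apply/res_exact0; exists (f m).
  by rewrite g0E.
have step n (s : {g | good n g}) : {s' : {g | good n.+1 g} |
    forall x, sval s' (res_d P n x) = res_d Q n (sval s x)}.
  case: s => g gP; apply: cid.
  have [h hE] := @injective_extend _ _ _ (res_d P n) (res_d Q n \o g)
    (@res_injective _ Q n.+1) gP.
  have hgood : good n.+1 h.
    by move=> x /res_exactS[y ->]; rewrite hE; apply/res_exactS; exists (g y).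
  by exists (exist _ h hgood).
pose G := fix G n : {g | good n g} :=
  match n return {g | good n g} with
  | 0 => exist _ g0 g0good
  | m.+1 => sval (step m (G m))
  end.
exists (fun n => sval (G n)); split=> [m|n x]; first exact: g0E.
exact: (svalP (step n (G n))).
Qed.

Lemma lift_homotopy (f : {linear M -> N}) g g' :
  lifts f g -> lifts f g' ->
  exists s : forall n, {linear P n.+1 -> Q n},
    (forall x, g 0 x = g' 0 x + s 0 (res_d P 0 x)) /\
    (forall n x, g n.+1 x =
      g' n.+1 x + (res_d Q n (s n x) + s n.+1 (res_d P n.+1 x))).
Proof.
move=> [ga gd] [ga' gd'].
have [h hE] : exists h : forall n, {linear P n -> Q n},
  forall n x, h n x = g n x - g' n x by exists (fun n => g n \- g' n).
have hd n x : h n.+1 (res_d P n x) = res_d Q n (h n x).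
  by rewrite !hE gd gd' linearB.
have h0 (x : P 0) : res_d P 0 x = 0 -> h 0 x = 0.
  by move=> /res_exact0[m ->]; rewrite hE ga ga' subrr.
have [s0 s0E] := injective_extend (@res_injective _ Q 0) h0.
pose good n (s : {linear P n.+1 -> Q n}) :=
  forall x, h n.+1 (res_d P n x) = res_d Q n (s (res_d P n x)).
have s0good : good 0 s0 by move=> x; rewrite hd s0E.
have step n (t : {s | good n s}) : {t' : {s | good n.+1 s} |
    forall x, h n.+1 x = res_d Q n (sval t x) + sval t' (res_d P n.+1 x)}.
  case: t => s sP; apply: cid.
  have [k kE] : exists k : {linear P n.+1 -> Q n.+1},
      forall x, k x = h n.+1 x - res_d Q n (s x).
    by exists (h n.+1 \- (res_d Q n \o s)).
  have k0 x : res_d P n.+1 x = 0 -> k x = 0.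
    by move=> /res_exactS[y ->]; rewrite kE sP subrr.
  have [s' s'E] := injective_extend (@res_injective _ Q n.+1) k0.
  have s'good : good n.+1 s'.
    move=> x; rewrite hd s'E kE.
    have e : res_d Q n.+1 (res_d Q n (s x)) = 0.
      by apply/res_exactS; exists (s x).
    by rewrite [RHS](linearB (res_d Q n.+1)) e subr0.
  exists (exist _ s' s'good) => x /=.
  by rewrite s'E kE addrC subrK.
pose G := fix G n : {s | good n s} :=
  match n return {s | good n s} with
  | 0 => exist _ s0 s0good
  | m.+1 => sval (step m (G m))
  end.
exists (fun n => sval (G n)); split=> [x|n x].
  by rewrite /= s0E hE addrC subrK.
have := svalP (step n (G n)) x; rewrite hE => e.
rewrite -[LHS](subrK (g' n.+1 x)) e addrC.
by [].
Qed.

Definition lift_map (f : {linear M -> N}) : forall n, {linear P n -> Q n} :=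
  sval (cid (lift_exists f)).

Lemma lift_mapP f : lifts f (lift_map f).
Proof. exact: svalP (cid (lift_exists f)). Qed.

End Lifting.

Lemma lifts_id M (P : injective_resolution M) :
  lifts (P := P) (Q := P) idfun (fun n => idfun).
Proof. by []. Qed.

Lemma lifts_comp (L M N : lmodType R) (P : injective_resolution L)
    (Q : injective_resolution M) (T : injective_resolution N)
    (g : {linear M -> N}) (f : {linear L -> M}) g' f' :
  lifts (P := Q) (Q := T) g g' -> lifts (P := P) (Q := Q) f f' ->
  lifts (P := P) (Q := T) (g \o f) (fun n => g' n \o f' n).
Proof.
move=> [ga gd] [fa fd].
by split=> [m|n x] /=; [rewrite fa ga | rewrite fd gd].
Qed.

Lemma lifts_add (M N : lmodType R) (P : injective_resolution M)
    (Q : injective_resolution N) (g f : {linear M -> N}) g' f' :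
  lifts (P := P) (Q := Q) g g' -> lifts (P := P) (Q := Q) f f' ->
  lifts (P := P) (Q := Q) (g \+ f) (fun n => g' n \+ f' n).
Proof.
move=> [ga gd] [fa fd].
by split=> [m|n x] /=; [rewrite fa ga linearD | rewrite fd gd linearD].
Qed.

End Resolutions.

Section Derived.
Variables (R S : pzRingType).
Variable res : forall M : lmodType R, injective_resolution M.
Variable F : functor R S.

Definition applied_d (M : lmodType R) n :
  {linear F (res M n) -> F (res M n.+1)} := fmap F (res_d (res M) n).

Lemma fmap0 (M N : lmodType R) (f : {linear M -> N}) x :
  (forall y, f y = 0) -> fmap F f x = 0.
Proof.
move=> f0; apply: (addrI (fmap F f x)); rewrite addr0.
rewrite -[LHS]/((fmap F f \+ fmap F f) x) -fmap_add.
by apply: fmap_ext => y /=; rewrite f0 addr0.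
Qed.

Section DerivedMap.
Variables (M N : lmodType R) (g : forall n, {linear res M n -> res N n}).
Hypothesis gd : forall n x,
  g n.+1 (res_d (res M) n x) = res_d (res N) n (g n x).

Lemma applied_lift n x :
  fmap F (g n.+1) (applied_d M n x) = applied_d N n (fmap F (g n) x).
Proof.
rewrite -[LHS]/((fmap F (g n.+1) \o fmap F _) x) -fmap_comp.
rewrite -[RHS]/((fmap F _ \o fmap F (g n)) x) -fmap_comp.
by apply: fmap_ext => y; apply: gd.
Qed.

Definition derived_of_lift n :
  {linear cohomology (applied_d M) n -> cohomology (applied_d N) n} :=
  cohomology_map applied_lift n.

Lemma derived_of_liftE n z :
  exists2 w : submod_of (cocycles (applied_d N) n),
    derived_of_lift n (coclass z) = coclass w &
    submod_val w = fmap F (g n) (submod_val z).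
Proof. by eexists; first exact: cohomology_mapE. Qed.
End DerivedMap.

Lemma derived_of_lift_eq (M N : lmodType R) (f : {linear M -> N}) g g'
    (gL : lifts (P := res M) (Q := res N) f g)
    (gL' : lifts (P := res M) (Q := res N) f g') n :
  derived_of_lift (proj2 gL) n =1 derived_of_lift (proj2 gL') n.
Proof.
move=> c; have [z ->] := coclass_surj c.
have [w -> wE] := derived_of_liftE (proj2 gL) z.
have [w' -> wE'] := derived_of_liftE (proj2 gL') z.
apply/coclass_eq; rewrite wE wE'.
have z0 : applied_d M n (submod_val z) = 0 by have /submod_of_closedP := valP z.
move: (submod_val z) z0 => {c z w w' wE wE'} x.
have [s [s0 sS]] := lift_homotopy gL gL'.
case: n x => [|n] x x0.
  have -> : fmap F (g 0) x = fmap F (g' 0 \+ (s 0 \o res_d (res M) 0)) x.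
    by apply: fmap_ext => y; rewrite s0.
  rewrite fmap_add /= fmap_comp /= -/(applied_d M 0) x0 linear0 addr0.
  by rewrite subrr.
have -> : fmap F (g n.+1) x =
  fmap F (g' n.+1 \+ ((res_d (res N) n \o s n) \+ (s n.+1 \o res_d (res M) n.+1))) x.
  by apply: fmap_ext => y; rewrite sS.
rewrite fmap_add /= fmap_add /= !fmap_comp /= -/(applied_d M n.+1) x0 linear0.
by rewrite addr0 addrC addKr; exists (fmap F (s n) x).
Qed.

Definition derived_map n (M N : lmodType R) (f : {linear M -> N}) :
  {linear cohomology (applied_d M) n -> cohomology (applied_d N) n} :=
  derived_of_lift (proj2 (lift_mapP (res M) (res N) f)) n.

Lemma derived_map_lift n (M N : lmodType R) (f : {linear M -> N}) g
    (gL : lifts (P := res M) (Q := res N) f g) :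
  derived_map n f =1 derived_of_lift (proj2 gL) n.
Proof. exact: derived_of_lift_eq. Qed.

Lemma derived_mapE n (M N : lmodType R) (f : {linear M -> N}) g z :
  lifts (P := res M) (Q := res N) f g ->
  exists2 w : submod_of (cocycles (applied_d N) n),
    derived_map n f (coclass z) = coclass w &
    submod_val w = fmap F (g n) (submod_val z).
Proof. by move=> gL; rewrite (derived_map_lift gL); apply: derived_of_liftE. Qed.

Lemma derived_map_ext n (M N : lmodType R) (f g : {linear M -> N}) :
  f =1 g -> derived_map n f =1 derived_map n g.
Proof.
move=> fg c; have [gA gd] := lift_mapP (res M) (res N) g.
have fL : lifts (P := res M) (Q := res N) f (lift_map (res M) (res N) g).
  by split=> // m; rewrite gA fg.
have [z ->] := coclass_surj c.
have [w -> wE] := derived_mapE z fL.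
have [w' -> wE'] := derived_mapE z (conj gA gd).
by apply: congr1; apply: val_inj; rewrite /= wE wE'.
Qed.

Lemma derived_map_id n (M : lmodType R) :
  derived_map n (idfun : {linear M -> M}) =1 id.
Proof.
move=> c; have [z ->] := coclass_surj c.
have [w -> wE] := derived_mapE z (lifts_id (res M)).
by apply: congr1; apply: val_inj; rewrite /= wE fmap_id.
Qed.

Lemma derived_map_comp n (L M N : lmodType R)
    (g : {linear M -> N}) (f : {linear L -> M}) :
  derived_map n (g \o f) =1 derived_map n g \o derived_map n f.
Proof.
move=> c; have [z ->] := coclass_surj c.
have fL := lift_mapP (res L) (res M) f; have gL := lift_mapP (res M) (res N) g.
have [w -> wE] := derived_mapE z (lifts_comp gL fL).
rewrite -[RHS]/(derived_map n g (derived_map n f (coclass z))).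
have [w' -> wE'] := derived_mapE z fL.
have [w'' -> wE''] := derived_mapE w' gL.
by apply: congr1; apply: val_inj; rewrite /= wE wE'' wE' fmap_comp.
Qed.

Lemma derived_map_add n (M N : lmodType R) (f g : {linear M -> N}) :
  derived_map n (f \+ g) =1 derived_map n f \+ derived_map n g.
Proof.
move=> c; have [z ->] := coclass_surj c.
have fL := lift_mapP (res M) (res N) f; have gL := lift_mapP (res M) (res N) g.
have [w -> wE] := derived_mapE z (lifts_add fL gL).
rewrite -[RHS]/(derived_map n f (coclass z) + derived_map n g (coclass z)).
have [w' -> wE'] := derived_mapE z fL.
have [w'' -> wE''] := derived_mapE z gL.
rewrite -linearD; apply: congr1; apply: val_inj.
by rewrite /= wE wE' wE'' fmap_add.
Qed.

Definition derived_nat n : functor R S :=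
  Functor (@derived_map_ext n) (@derived_map_id n) (@derived_map_comp n)
    (@derived_map_add n).

(* The values on morphisms use arbitrary lifts to the resolutions res; see
   derived_map_lift for the independence of the choice. *)
Definition derived (i : int) : functor R S :=
  match i with
  | Posz n => derived_nat n
  | Negz _ => zero_functor R S
  end.

Section ToR0.
Variable M : lmodType R.

Lemma to_R0_cocycle (x : F M) :
  fmap F (res_aug (res M)) x \in cocycles (applied_d M) 0.
Proof.
apply/submod_of_closedP.
rewrite -[LHS]/((fmap F (res_d (res M) 0) \o fmap F _) x) -fmap_comp.
by apply: fmap0 => y; apply/res_exact0; exists y.
Qed.

Definition to_R0_cocycle_fun (x : F M) : submod_of (cocycles (applied_d M) 0) :=
  SubmodOf (to_R0_cocycle x).

Lemma to_R0_linear : linear (fun x : F M => coclass (to_R0_cocycle_fun x)).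
Proof.
move=> a x y; rewrite -linearP; congr (quot_proj _ _).
by apply: val_inj; rewrite /= linearP.
Qed.

Definition to_R0_map : {linear F M -> derived 0 M} := linear_of to_R0_linear.
End ToR0.

Lemma to_R0_natural (M N : lmodType R) (f : {linear M -> N}) (x : F M) :
  to_R0_map N (fmap F f x) = fmap (derived 0) f (to_R0_map M x).
Proof.
have fL := lift_mapP (res M) (res N) f.
have [w e wE] := derived_mapE (to_R0_cocycle_fun x) fL.
rewrite -[RHS]/(derived_map 0 f (coclass (to_R0_cocycle_fun x))) e.
apply: (congr1 (@coclass _ _ _ _)); apply: val_inj; rewrite /= wE /=.
rewrite -[LHS]/((fmap F _ \o fmap F f) x) -fmap_comp.
rewrite -[RHS]/((fmap F _ \o fmap F _) x) -fmap_comp.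
by apply: fmap_ext => m /=; rewrite (proj1 fL).
Qed.

Definition to_R0 : nat_trans F (derived 0) := NatTrans to_R0_natural.

End Derived.

(* Hom_R(T, _), hence Ext, takes its values in right modules since T is a
   two-sided ideal. *)
Definition Ext (R : pzRingType)
    (res : forall M : lmodType R^c, injective_resolution M)
    (T : two_sided_ideal R) (i : int) : functor R^c R^c :=
  derived res (hom_functor T) i.

(* Main.v *)
Require Import Defs.
From mathcomp Require Import all_boot all_order all_algebra.
From mathcomp Require Import boolp.

Set Implicit Arguments.
Unset Strict Implicit.
Unset Printing Implicit Defensive.

Import GRing.Theory.
Local Open Scope ring_scope.

(* Let E be an injective envelope of R with unit u, and T the trace. Every element
   of an injective left module is g u for some linear g : E -> _, so T consists of
   the sums of elements f u with f : E -> R linear. When E is finitely presented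
   and J is an injective right module, J (x) E embeds in Hom(Hom(E, R), J), so
   m (x) u = 0 in J (x) E as soon as m annihilates T; hence beta_J is injective. It
   is surjective because maps T -> J extend to R. So beta is an isomorphism on
   injective modules, and induces isomorphisms on the derived functors; finally
   R^0 Hom(T, _) = Hom(T, _) by left exactness. *)

(** * Factoring linear maps through surjections and injections *)

Lemma inj_surj_bij (A B : Type) (f : A -> B) :
  injective f -> (forall y, exists x, y = f x) -> bijective f.
Proof.
move=> fI fS; have [g gP] := choice fS.
by exists g => [x|y]; [apply: fI|]; rewrite -gP.
Qed.

(** Any set-theoretic section of [p] serves: two preimages of a point differ by an element of the
    kernel of [p], where [g] vanishes. *)
Lemma linear_factor_surj (R : pzRingType) (A B C : lmodType R)
    (p : {linear A -> B}) (g : {linear A -> C}) :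
  (forall y, exists x, p x = y) -> (forall x, p x = 0 -> g x = 0) ->
  exists f : {linear B -> C}, forall x, f (p x) = g x.
Proof.
move=> ps pg; have [s sP] := choice ps.
have sE x : g (s (p x)) = g x.
  by apply/eqP; rewrite -subr_eq0 -linearB pg // linearB sP subrr.
have fL : linear (fun y => g (s y)).
  by move=> a x y; rewrite -[x]sP -[y]sP -linearP !sE linearP.
by exists (linear_of fL).
Qed.

(** Pointwise chosen preimages are automatically linear, since [j] can be cancelled. *)
Lemma linear_factor_inj (R : pzRingType) (A B C : lmodType R)
    (j : {linear B -> C}) (g : {linear A -> C}) :
  injective j -> (forall x, exists y, g x = j y) ->
  exists f : {linear A -> B}, forall x, j (f x) = g x.
Proof.
move=> jI jg; have [f fP] := choice jg.
have fL : linear f by move=> a x y; apply: jI; rewrite linearP -!fP linearP.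
by exists (linear_of fL) => x; rewrite /= fP.
Qed.

Lemma bijective_linear_inv (R : pzRingType) (A B : lmodType R)
    (f : {linear A -> B}) : bijective f ->
  exists g : {linear B -> A}, cancel f g /\ cancel g f.
Proof.
move=> [h fK hK].
have [|g gP] := @linear_factor_inj _ _ _ _ f idfun (can_inj fK).
  by move=> x; exists (h x); rewrite hK.
by exists g; split=> x //; apply: (can_inj fK); rewrite gP.
Qed.

(** * Vanishing of tensors with a finitely presented module *)

Section TensorSums.
Variables (R : pzRingType) (M : lmodType R^c) (N : lmodType R).

Lemma tens0r (x : M) : tens x (0 : N) = 0.
Proof. by apply: (addrI (tens x 0)); rewrite -tensDr !addr0. Qed.

Lemma tens_suml (I : finType) (F : I -> M) (y : N) :
  tens (\sum_i F i) y = \sum_i tens (F i) y.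
Proof.
apply: (big_morph (fun x => tens x y)) => [u v|]; [exact: tensDl | exact: tens0l].
Qed.

Lemma tens_sumr (I : finType) (x : M) (F : I -> N) :
  tens x (\sum_i F i) = \sum_i tens x (F i).
Proof.
by apply: (big_morph (tens x)) => [u v|]; [exact: tensDr | exact: tens0r].
Qed.

End TensorSums.

Lemma tens_map_eq0 (R : pzRingType) (M : lmodType R^c) (N N' : lmodType R)
    (g : {linear N -> N'}) (x : M) (y : N) :
  tens x y = 0 -> tens x (g y) = 0.
Proof.
by move=> xy0; rewrite -tensor_mapE xy0 -(tens0l M 0) tensor_mapE tens0l.
Qed.

(* With z in R^n representing y and K the matrix of relations of N, the map
   c |-> x (z . c) kills ker K = Hom(N, R), so it factors as w \o K since J is
   injective. Then x (x) y = sum_i w(e_i) (x) p(k_i) = 0. *)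
Lemma tens_eq0_of_dual (R : pzRingType) (N : lmodType R) (J : lmodType R^c)
    (x : J) (y : N) :
  finitely_presented N -> injective_module J ->
  (forall f : {linear N -> R^o}, (f y : R^c) *: x = 0) -> tens x y = 0.
Proof.
move=> [n [p [ps [m [k kP]]]]] Jinj xy0; have [z yE] := ps y.
pose dot (a : 'rV[R]_n) (c : 'rV[R^c]_n) : R := \sum_j a 0 j * (c 0 j : R).
(* Scaling in [R^c] is right multiplication in [R], so pairing with fixed rows is linear in [c]. *)
have KL : linear (fun c => \row_i (dot (k i) c : R^c)).
  move=> a u v; apply/rowP=> i; rewrite !mxE /dot.
  rewrite [RHS](_ : _ = (\sum_j k i 0 j * (u 0 j : R)) * (a : R) +
    \sum_j k i 0 j * (v 0 j : R)) // mulr_suml -big_split /=.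
  by apply: eq_bigr => j _; rewrite !mxE mulrDr; congr (_ + _); rewrite -mulrA.
have vL : linear (fun c => (dot z c : R^c) *: x).
  move=> a u v; rewrite scalerA -scalerDl; congr (_ *: _); rewrite /dot.
  rewrite [RHS](_ : _ = (\sum_j z 0 j * (u 0 j : R)) * (a : R) +
    \sum_j z 0 j * (v 0 j : R)) // mulr_suml -big_split /=.
  by apply: eq_bigr => j _; rewrite !mxE mulrDr; congr (_ + _); rewrite -mulrA.
have [|w wE] := @injective_extend _ J _ _ (linear_of KL) (linear_of vL) Jinj.
  move=> c /rowP c0 /=.
  (* If K c = 0, pairing with [c] kills every relation [k i], so it descends along [p] to some [f]
     on [N] with f(y) = z . c. *)
  have gL : linear (fun a => dot a c : R^o).
    move=> b u v; rewrite /dot scaler_sumr -big_split /=.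
    by apply: eq_bigr => j _; rewrite !mxE mulrDl; congr (_ + _); rewrite -mulrA.
  have [|f fE] := @linear_factor_surj _ _ _ _ p (linear_of gL) ps.
    move=> a /kP[b ->]; rewrite linear_sum big1 // => i _.
    by rewrite linearZ /=; have := c0 i; rewrite !mxE => ->; rewrite scaler0.
  by have := xy0 f; rewrite -yE fE.
have dotE a j : dot a (delta_mx 0 j) = a 0 j.
  rewrite /dot (bigD1 j) //= big1 ?addr0 => [|i ij].
    by rewrite mxE !eqxx; exact: mulr1.
  by rewrite mxE (negPf ij) andbF; exact: mulr0.
(* This is the factorization [wE] read at the j-th basis vector. *)
have xz j : (z 0 j : R^c) *: x = \sum_i (k i 0 j : R^c) *: w (delta_mx 0 i).
  have := wE (delta_mx 0 j); rewrite /= dotE => <-.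
  rewrite [X in w X]row_sum_delta linear_sum; apply: eq_bigr => i _.
  by rewrite linearZ /= mxE dotE.
(* Coefficients cross the tensor sign twice: the entries of [z] go left to be replaced by [xz], then
   the entries of each [k i] go back right and reassemble p(k_i). *)
rewrite -yE [z]row_sum_delta linear_sum tens_sumr.
under eq_bigr => j _ do rewrite linearZ /= -tens_balanced xz tens_suml.
rewrite exchange_big big1 //= => i _.
under eq_bigr => j _ do rewrite tens_balanced -linearZ /=.
rewrite -tens_sumr -linear_sum -row_sum_delta.
rewrite [p _](_ : _ = 0) ?tens0r //; apply/kP.
(* [k i] is itself a relation: its coefficients are the i-th unit vector. *)
exists (fun l => (l == i)%:R); rewrite (bigD1 i) //= eqxx scale1r big1 ?addr0 //.
by move=> l /negPf ->; rewrite scale0r.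
Qed.

(** * [beta] on injective modules *)

Section BetaInjective.
Variables (R : pzRingType) (E : injective_envelope R^o).

Lemma envelope_trace (E' : injective_envelope R^o) (f : {linear E' -> R^o}) :
  (f (env_map E' (1 : R^o)) : right_regular R) \in trace_ideal R.
Proof.
apply/submod_of_closedP; exists [:: f (env_map E' (1 : R^o))].
  move=> z; rewrite inE => /eqP ->; exists E', f, (env_map E' (1 : R^o)).
  by split=> //; apply: env_injective.
by rewrite big_seq1.
Qed.

(** The finitely presented envelope [E'] given by [left_FPE] may differ from [E]. The vanishing is
    proved in the tensor product with [E'] and carried to [E] by a map matching the two images of
    1. *)
Lemma trace_annihilated_torsion (J : lmodType R^c) (x : J) :
  left_FPE R -> injective_module J ->
  (forall t : right_regular R, t \in trace_ideal R -> (t : R^c) *: x = 0) ->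
  x \in torsion E J.
Proof.
move=> [E' fpE'] Jinj xT; apply/submod_of_closedP/in_torsionE.
have [g <-] := extend_iota E' (env_map E (1 : R^o)) (@env_injective _ _ E).
apply/tens_map_eq0/tens_eq0_of_dual => // f; exact/xT/envelope_trace.
Qed.

Lemma beta_bijective (J : lmodType R^c) :
  left_FPE R -> injective_module J -> bijective (beta E J).
Proof.
move=> R_FPE Jinj.
have bI : injective (beta E J).
  apply: raddf_inj => q; rewrite -[q]quot_proj_surj; move: (repr q) => x b0.
  apply/quot_proj_eq0/trace_annihilated_torsion => // t tT.
  rewrite -[LHS](beta_mapE E x (SubmodOf tT)).
  by have -> : beta_map E J (quot_proj _ x) = 0 by exact: b0.
have bS (h : Defs.hom (trace_ideal R) J) : exists q, h = beta E J q.
  have vL : linear (fun t : submod_of (trace_ideal R) => submod_val t).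
    by [].
  have [|w wE] := @injective_extend _ J _ _ (linear_of vL) h Jinj.
    by move=> t t0; rewrite (_ : t = 0) ?linear0 //; apply: val_inj.
  (* Extending [h] to [w] on the whole ring makes it multiplication by w(1), since t = 1 t. *)
  exists (quot_proj _ (w (1 : R^c))); apply: hom_eq => t.
  rewrite -wE [RHS](beta_mapE E _ t) -linearZ; congr (w _).
  exact: (esym (mulr1 (submod_val t : R^c))).
exact: inj_surj_bij.
Qed.

End BetaInjective.

(** * Composites and inverses of natural transformations *)

Section NatTrans.
Variables (R S : pzRingType) (F G H : functor R S).

Lemma nat_comp (t : nat_trans G H) (u : nat_trans F G) :
  exists v : nat_trans F H, forall M x, v M x = t M (u M x).
Proof.
have vN (M N : lmodType R) (f : {linear M -> N}) (x : F M) :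
    (t N \o u N) (fmap F f x) = fmap H f ((t M \o u M) x).
  by rewrite /= !nt_natural.
by exists (@NatTrans _ _ F H (fun M => t M \o u M) vN).
Qed.

Lemma nat_iso_inv (t : nat_trans F G) : is_nat_iso t ->
  exists u : nat_trans G F,
    forall M, cancel (t M) (u M) /\ cancel (u M) (t M).
Proof.
move=> tB.
pose u M := sval (cid (bijective_linear_inv (tB M))).
have uP M : cancel (t M) (u M) /\ cancel (u M) (t M).
  exact: svalP (cid (bijective_linear_inv (tB M))).
have uN (M N : lmodType R) (f : {linear M -> N}) (x : G M) :
    u N (fmap G f x) = fmap F f (u M x).
  apply: (can_inj (uP N).1); rewrite nt_natural (uP N).2.
  by rewrite (uP M).2.
by exists (NatTrans uN).
Qed.

End NatTrans.

(** * Derived functors of a natural transformation *)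

Section DerivedNat.
Variables (R S : pzRingType).
Variable res : forall M : lmodType R, injective_resolution M.
Variables (F G : functor R S) (t : nat_trans F G).

Lemma nat_applied_d (M : lmodType R) n (x : F (res M n)) :
  t (res M n.+1) (applied_d res F M n x) = applied_d res G M n (t (res M n) x).
Proof. exact: nt_natural. Qed.

Definition derived_nt_map n (M : lmodType R) :
  {linear derived_nat res F n M -> derived_nat res G n M} :=
  cohomology_map (@nat_applied_d M) n.

Lemma derived_nt_mapE n (M : lmodType R)
    (z : submod_of (cocycles (applied_d res F M) n)) :
  exists2 w : submod_of (cocycles (applied_d res G M) n),
    derived_nt_map n M (coclass z) = coclass w &
    submod_val w = t (res M n) (submod_val z).
Proof. by eexists; first exact: cohomology_mapE. Qed.

(** One lift of [f] to the resolutions computes both derived maps, so on representing cocycles the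
    square is naturality of [t] at that lift. *)
Lemma derived_nt_natural n (M N : lmodType R) (f : {linear M -> N})
    (c : derived_nat res F n M) :
  derived_nt_map n N (fmap (derived_nat res F n) f c) =
  fmap (derived_nat res G n) f (derived_nt_map n M c).
Proof.
have fL := lift_mapP (res M) (res N) f; have [z ->] := coclass_surj c.
have [w1 e1 v1] := derived_mapE z fL.
have [w2 e2 v2] := derived_nt_mapE z.
have [w3 e3 v3] := derived_mapE w2 fL.
have [w4 e4 v4] := derived_nt_mapE w1.
rewrite -[fmap _ f _]/(derived_map res F n f (coclass z)) e1 e4 e2.
rewrite -[RHS]/(derived_map res G n f (coclass w2)) e3.
by apply: congr1; apply: val_inj; rewrite /= v3 v4 v1 v2 nt_natural.
Qed.

Definition derived_nt n :
  nat_trans (derived_nat res F n) (derived_nat res G n) :=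
  NatTrans (@derived_nt_natural n).

(** On cocycles this is naturality of [t] at the augmentation. *)
Lemma derived_nt_to_R0 (M : lmodType R) (x : F M) :
  derived_nt 0 M (to_R0 res F M x) = to_R0 res G M (t M x).
Proof.
have [w e v] := derived_nt_mapE (to_R0_cocycle_fun res x).
rewrite -[LHS]/(derived_nt_map 0 M (coclass (to_R0_cocycle_fun res x))) e.
apply: (congr1 (@coclass _ _ _ _)); apply: val_inj.
by rewrite /= v /= nt_natural.
Qed.

(** The terms of a resolution are injective, so [t] is an isomorphism between the two complexes and
    hence on their cohomology. *)
Lemma derived_nt_iso n :
  (forall J : lmodType R, injective_module J -> bijective (t J)) ->
  is_nat_iso (derived_nt n).
Proof.
move=> tB M; have {}tB m := tB _ (@res_injective _ _ (res M) m).
have tK m := bij_inj (tB m).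
have tS m (y : G (res M m)) : exists x, y = t _ x.
  by have [g _ gK] := tB m; exists (g y); rewrite gK.
have I : injective (derived_nt n M).
  apply: raddf_inj => c; have [z ->] := coclass_surj c.
  have [w e v] := derived_nt_mapE z.
  move=> e0; have {e0 e} /quot_proj_eq0/submod_of_closedP := etrans (esym e) e0.
  rewrite v => b; apply/quot_proj_eq0/submod_of_closedP.
  (* In degree 0 only zero is a coboundary; above it, a bounding element is pulled back along
     [t]. *)
  case: n c z w v b => [|n] c z w v /=.
    by move=> b; apply: (tK 0); rewrite b linear0.
  move=> [y]; have [x ->] := tS _ y => b; exists x; apply: (tK n.+1).
  by rewrite b nat_applied_d.
have Sj c' : exists c, c' = derived_nt n M c.
  have [w ->] := coclass_surj c'; have [x wE] := tS n (submod_val w).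
  have xc : x \in cocycles (applied_d res F M) n.
    apply/submod_of_closedP; apply: (tK n.+1).
    by rewrite nat_applied_d -wE linear0; have /submod_of_closedP := valP w.
  exists (coclass (SubmodOf xc)).
  have [w' e v] := derived_nt_mapE (SubmodOf xc).
  rewrite -[RHS]/(derived_nt_map n M (coclass (SubmodOf xc))) e.
  by apply: congr1; apply: val_inj; rewrite /= v.
exact: inj_surj_bij.
Qed.

End DerivedNat.

(** * Left exactness of Hom and the derived functors of [torsion_quotient] *)

(** A 0-cocycle is a map from [T] to the first term of the resolution that the differential kills;
    by exactness it factors uniquely through the augmentation. *)
Lemma to_R0_hom_iso (R : pzRingType) (T : two_sided_ideal R)
    (res : forall M : lmodType R^c, injective_resolution M) :
  is_nat_iso (to_R0 res (hom_functor T)).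
Proof.
move=> M.
have I : injective (to_R0 res (hom_functor T) M).
  move=> h h' /coclass_eq /= /eqP; rewrite subr_eq0 => /eqP e.
  apply: hom_eq => t; apply: (@res_aug_inj _ _ (res M)).
  exact: (congr1 (fun f : Defs.hom T (res M 0) => f t) e).
have Sj c : exists h, c = to_R0 res (hom_functor T) M h.
  have [z ->] := coclass_surj c.
  have /submod_of_closedP z0 := valP z.
  have [|h hE] := @linear_factor_inj _ _ _ _ (res_aug (res M))
      (submod_val z : Defs.hom T (res M 0)) (@res_aug_inj _ _ (res M)).
    move=> t; apply/res_exact0.
    exact: (congr1 (fun f : Defs.hom T (res M 1) => f t) z0).
  exists h; apply: (congr1 (@coclass _ _ _ _)); apply: val_inj.
  by apply: hom_eq => t; rewrite /= -hE.
exact: inj_surj_bij.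
Qed.

Theorem theorem5p5 (R : pzRingType) (R_FPE : left_FPE R)
  (E : injective_envelope R^o)
  (res : forall M : lmodType R^c, injective_resolution M) :
  (exists phi : nat_trans (derived res (torsion_quotient E) 0)
                          (hom_functor (trace_ideal R)),
     is_nat_iso phi /\
     forall (M : lmodType R^c) (x : torsion_quotient E M),
       phi M (to_R0 res (torsion_quotient E) M x) = beta E M x) /\
  (forall i : int,
     nat_isomorphic (derived res (torsion_quotient E) i)
                    (Ext res (trace_ideal R) i)).
Proof.
have bI n : is_nat_iso (derived_nt res (beta E) n).
  by apply: derived_nt_iso => J; apply: beta_bijective.
split.
  have [u uP] := nat_iso_inv (to_R0_hom_iso (trace_ideal R) res).
  (* [phi] is R^0 of [beta] followed by the inverse of the canonical map from Hom to its R^0. *)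
  have [phi phiE] := nat_comp u (derived_nt res (beta E) 0).
  exists phi; split=> [M|M x].
    apply: (eq_bij (f := u M \o derived_nt res (beta E) 0 M)).
      apply: (bij_comp _ (bI 0 M)).
      by have [tK uK] := uP M; exists (to_R0 res (hom_functor (trace_ideal R)) M).
    by move=> x; rewrite phiE.
  by rewrite phiE derived_nt_to_R0 (uP M).1.
(* In negative degrees both sides are [zero_functor], and the identity is the isomorphism. *)
case=> n; first exact: (ex_intro _ _ (bI n)).
have idN (M N : lmodType R^c) (f : {linear M -> N})
  (x : zero_functor R^c R^c M) : idfun (fmap (zero_functor R^c R^c) f x) =
    fmap (zero_functor R^c R^c) f (idfun x) by [].
by exists (@NatTrans _ _ (zero_functor R^c R^c) (zero_functor R^c R^c)
  (fun=> idfun) idN) => M; exists id.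
Qed.
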